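(* Let $\mathcal{S}$ be a trajectory set (with $d+1$ assets), and consider a node $(\mathbf{S},k)$, $\mathbf{S}\in\mathcal{S}$, $k\ge0$. Let $\Delta X(\mathcal{S}_{(\mathbf{S},k)})=\{X(S'_{k+1})-X(S'_k):\mathbf{S}'\in\mathcal{S}_{(\mathbf{S},k)}\}\subseteq\mathbb{R}^d$. 1. If $0\in\mathrm{ri}(\mathrm{co}(\Delta X(\mathcal{S}_{(\mathbf{S},k)})))$, then $(\mathbf{S},k)$ is an arbitrage-free node with respect to any admissible portfolio set $\mathcal{H}$. 2. If $0\in\mathrm{cl}(\mathrm{co}(\Delta X(\mathcal{S}_{(\mathbf{S},k)})))$, then $(\mathbf{S},k)$ is a $0$-neutral node with respect to any admissible portfolio set $\mathcal{H}$.
   Context: Trajectory set: given subsets $\Sigma_i\subseteq\mathbb{R}^{d+1}$, sets $\Omega_i$ ($i\ge0$), $\Theta\subseteq\mathbb{N}$, $s_0\in\mathbb{R}^{d+1}$, $w_0\in\Omega_0$, a trajectory set $\mathcal{S}$ is a set of sequences $\mathbf{S}=\{\mathbf{S}_i=(S_i,W_i,m)\}_{i\ge0}$ with $S_i=(S_i^0,\dots,S_i^d)\in\Sigma_i$, $W_i\in\Omega_i$, $m\in\Theta$, $(S_0,W_0)=(s_0,w_0)$; it is assumed throughout that $S^0_i>0$ for all $i$. Put $M(\mathbf{S})=m$ and $\mathcal{S}_{(\mathbf{S},k)}=\{\mathbf{S}'\in\mathcal{S}:\mathbf{S}'_i=\mathbf{S}_i,\ 0\le i\le k,\ M(\mathbf{S}')>k\}$.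 The perspective function is $X(s)=(s^1/s^0,\dots,s^d/s^0)$ for $s\in\mathbb{R}^{d+1}$ with $s^0>0$. A portfolio is a sequence $\Phi=\{(H^0_i,H_i)\}_{i\ge0}$ of functions $H^0_i:\mathcal{S}\to\mathbb{R}$, $H_i:\mathcal{S}\to\mathbb{R}^d$ such that whenever $\mathbf{S}'_i=\mathbf{S}_i$ for $0\le i\le k$ with $k<\min\{M(\mathbf{S}),M(\mathbf{S}')\}$, then $\Phi_k(\mathbf{S})=\Phi_k(\mathbf{S}')$. It is self-financing if $H^0_i(\mathbf{S})S^0_{i+1}+H_i(\mathbf{S})\cdot(S^1_{i+1},\dots,S^d_{i+1})=H^0_{i+1}(\mathbf{S})S^0_{i+1}+H_{i+1}(\mathbf{S})\cdot(S^1_{i+1},\dots,S^d_{i+1})$ for all $\mathbf{S}\in\mathcal{S}$, $i\ge0$. A set $\mathcal{H}$ of portfolios is admissible if all its members are self-financing, $0\in\mathcal{H}$, and for each $\mathbf{S}\in\mathcal{S}$, $\Phi\in\mathcal{H}$ there is $N_\Phi(\mathbf{S})\in\mathbb{N}$ with $\Phi_k(\mathbf{S})=0$ for all $k\ge N_\Phi(\mathbf{S})$. The node $(\mathbf{S},k)$ is arbitrage-free with respect to $\mathcal{H}$ if for every $\Phi=(H^0,H)\in\mathcal{H}$: either $H_k(\mathbf{S})\cdot(X(S'_{k+1})-X(S'_k))=0$ for all $\mathbf{S}'\in\mathcal{S}_{(\mathbf{S},k)}$, or $\inf_{\mathbf{S}'\in\mathcal{S}_{(\mathbf{S},k)}}H_k(\mathbf{S})\cdot(X(S'_{k+1})-X(S'_k))<0$.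 It is $0$-neutral with respect to $\mathcal{H}$ if for every $\Phi=(H^0,H)\in\mathcal{H}$: $\inf_{\mathbf{S}'\in\mathcal{S}_{(\mathbf{S},k)}}H_k(\mathbf{S})\cdot(X(S'_{k+1})-X(S'_k))\le0$. Infima are in the extended reals; $\mathrm{co}$, $\mathrm{cl}$, $\mathrm{ri}$ denote convex hull, closure, relative interior. *)

(* Defs.v *)
From HB Require Import structures.
From mathcomp Require Import all_boot all_order all_algebra.
From mathcomp Require Import all_classical all_reals all_analysis.

Set Implicit Arguments.
Unset Strict Implicit.
Unset Printing Implicit Defensive.

Import Order.TTheory GRing.Theory Num.Theory.
Import numFieldNormedType.Exports.

Local Open Scope classical_set_scope.
Local Open Scope ring_scope.

Definition convex_hull (R : numDomainType) (V : lmodType R) (A : set V) :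
    set V :=
  smallest (@convex_set R V) A.

Definition affine_set (R : numDomainType) (V : lmodType R) (A : set V) : Prop :=
  forall (x y : V) (t : R), A x -> A y -> A (t *: x + (1 - t) *: y).

Definition affine_hull (R : numDomainType) (V : lmodType R) (A : set V) :
    set V :=
  smallest (@affine_set R V) A.

Definition relative_interior (R : numFieldType) (V : normedModType R)
    (C : set V) : set V :=
  [set x | affine_hull C x /\ within (affine_hull C) (nbhs x) C].

Definition dot (R : pzRingType) (d : nat) (u v : 'rV[R]_d) : R :=
  \sum_(j < d) u 0 j * v 0 j.

(* s : 'rV_d.+1 lists the prices (s^0, ..., s^d); s^0 is the numeraire. *)
Definition numeraire (R : pzRingType) (d : nat) (s : 'rV[R]_d.+1) : R :=
  s 0 ord0.

Definition risky (R : pzRingType) (d : nat) (s : 'rV[R]_d.+1) : 'rV[R]_d :=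
  \row_(j < d) s 0 (lift ord0 j).

(* The mathematical domain is numeraire s > 0. *)
Definition perspective (R : unitRingType) (d : nat) (s : 'rV[R]_d.+1) :
    'rV[R]_d :=
  \row_(j < d) (risky s 0 j / numeraire s).

(* A sequence of triples (S_i, W_i, m) whose third component is constant.
   The sets containing the W_i are taken inside one type U. *)
Record trajectory (R : Type) (d : nat) (U : Type) := Trajectory {
  price : nat -> 'rV[R]_d.+1;
  info : nat -> U;
  horizon : nat }.

Definition entry (R U : Type) (d : nat) (S : trajectory R d U) (i : nat) :
    'rV[R]_d.+1 * U * nat :=
  (price S i, info S i, horizon S).

Definition agree_upto (R U : Type) (d : nat) (k : nat)
    (S S' : trajectory R d U) : Prop :=
  forall i : nat, (i <= k)%N -> entry S' i = entry S i.

Definition trajectory_set (R : realType) (d : nat) (U : Type)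
    (Sigma : nat -> set 'rV[R]_d.+1) (Omega : nat -> set U) (Theta : set nat)
    (s0 : 'rV[R]_d.+1) (w0 : U) (TS : set (trajectory R d U)) : Prop :=
  forall S, TS S ->
    [/\ forall i, Sigma i (price S i),
        forall i, Omega i (info S i),
        Theta (horizon S),
        (price S 0%N, info S 0%N) = (s0, w0)
      & forall i, 0 < numeraire (price S i)].

Section Market.
Variables (R : realType) (d : nat) (U : Type) (TS : set (trajectory R d U)).

(* TS, used as a type, is the subtype of its elements; val is the inclusion. *)

Definition node_set (S : TS) (k : nat) : set TS :=
  [set S' : TS | agree_upto k (val S) (val S') /\ (k < horizon (val S'))%N].

Definition increment (k : nat) (S : TS) : 'rV[R]_d :=
  perspective (price (val S) k.+1) - perspective (price (val S) k).

Definition node_increments (S : TS) (k : nat) : set 'rV[R]_d :=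
  [set increment k S' | S' in node_set S k].

(* Phi k S is the pair (H^0_k(S), H_k(S)). *)
Definition position := nat -> TS -> R * 'rV[R]_d.

Definition portfolio (Phi : position) : Prop :=
  forall (S S' : TS) (k : nat), agree_upto k (val S) (val S') ->
    (k < minn (horizon (val S)) (horizon (val S')))%N -> Phi k S = Phi k S'.

Definition self_financing (Phi : position) : Prop :=
  forall (S : TS) (i : nat),
    let s := price (val S) i.+1 in
    (Phi i S).1 * numeraire s + dot (Phi i S).2 (risky s) =
    (Phi i.+1 S).1 * numeraire s + dot (Phi i.+1 S).2 (risky s).

Definition admissible (H : set position) : Prop :=
  [/\ forall Phi, H Phi -> portfolio Phi,
      forall Phi, H Phi -> self_financing Phi,
      H (fun _ _ => (0, 0))
    & forall (S : TS) Phi, H Phi ->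
        exists N : nat, forall k : nat, (N <= k)%N -> Phi k S = (0, 0)].

(* H_k(S) . (X(S'_{k+1}) - X(S'_k)): the position is taken at S, the price
   increment along S'. *)
Definition node_gain (Phi : position) (S : TS) (k : nat) (S' : TS) : R :=
  dot (Phi k S).2 (increment k S').

(* The infimum is in \bar R: it is +oo when the node set is empty. *)
Definition inf_node_gain (Phi : position) (S : TS) (k : nat) : \bar R :=
  ereal_inf [set (node_gain Phi S k S')%:E | S' in node_set S k].

Definition arbitrage_free_node (H : set position) (S : TS) (k : nat) : Prop :=
  forall Phi, H Phi ->
    (forall S', node_set S k S' -> node_gain Phi S k S' = 0) \/
    (inf_node_gain Phi S k < 0)%E.

Definition zero_neutral_node (H : set position) (S : TS) (k : nat) : Prop :=
  forall Phi, H Phi -> (inf_node_gain Phi S k <= 0)%E.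

End Market.

(* Main.v *)
(* A half-space {x | c <= h.x} that contains the increments of a node contains
   their convex hull and, being closed, the closure of the hull; if 0 lies
   there then c <= 0, which is the second part. For the first part take c = 0:
   near the relative interior point 0 the hull contains t *: x for each
   increment x and small t < 0, so that h.x <= 0 as well. *)
Require Import Defs.
From HB Require Import structures.
From mathcomp Require Import all_boot all_order all_algebra.
From mathcomp Require Import all_classical all_reals all_analysis.

Set Implicit Arguments.
Unset Strict Implicit.
Unset Printing Implicit Defensive.

Import Order.TTheory GRing.Theory Num.Theory.
Import numFieldNormedType.Exports.

Local Open Scope classical_set_scope.
Local Open Scope ring_scope.

Lemma dotDr (R : pzRingType) (d : nat) (h x y : 'rV[R]_d) :
  dot h (x + y) = dot h x + dot h y.
Proof. by rewrite /dot -big_split; apply: eq_bigr => j _; rewrite mxE mulrDr. Qed.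

Lemma dotZr (R : comPzRingType) (d : nat) (h x : 'rV[R]_d) (t : R) :
  dot h (t *: x) = t * dot h x.
Proof. by rewrite /dot mulr_sumr; apply: eq_bigr => j _; rewrite mxE mulrCA. Qed.

Lemma dotr0 (R : pzRingType) (d : nat) (h : 'rV[R]_d) : dot h 0 = 0.
Proof. by rewrite /dot big1 // => j _; rewrite mxE mulr0. Qed.

Lemma dot_continuous (R : realType) (d : nat) (h : 'rV[R]_d) :
  continuous (dot h).
Proof.
move=> x; apply: cvg_big => [||j _].
- exact: add_continuous.
- exact: (nbhs_filter x).
- by apply: (@cvgM _ _ _ (nbhs_filter x)); [exact: cvg_cst|exact: coord_continuous].
Qed.

Lemma convex_hull_dot_ge (R : realType) (d : nat) (h : 'rV[R]_d) (c : R)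
    (A : set 'rV[R]_d) :
  A `<=` [set x | c <= dot h x] -> convex_hull A `<=` [set x | c <= dot h x].
Proof.
apply: smallest_sub => x y t; rewrite !inE /= => cx cy.
change (c <= dot h (t%:num *: x + (1 - t%:num) *: y)).
(* With [c] split in the same weights, the inequality follows term by term. *)
have -> : c = t%:num * c + (1 - t%:num) * c by rewrite -mulrDl subrKC mul1r.
rewrite dotDr !dotZr.
by apply: lerD; apply: ler_wpM2l; rewrite // subr_ge0.
Qed.

Lemma closure_dot_ge (R : realType) (d : nat) (h : 'rV[R]_d) (c : R)
    (A : set 'rV[R]_d) :
  A `<=` [set x | c <= dot h x] -> closure A `<=` [set x | c <= dot h x].
Proof.
move=> /closureS subA x /subA.
apply: (@preimage_closed _ _ (dot h) [set y | c <= y]); last exact: closed_ge.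
by move=> y _; exact: dot_continuous.
Qed.

(** The line through 0 and [x] stays in the affine hull of [C], so near 0, on either side, it lies
    in [C]. *)
Lemma relative_interior0_opp (R : realType) (V : normedModType R) (C : set V)
    (x : V) :
  relative_interior C 0 -> C x -> exists2 t : R, t < 0 & C (t *: x).
Proof.
move=> [aff0 C0] Cx.
have Zx : t *: x @[t --> (0 : R)^'-] --> (0 : V).
  rewrite -[X in _ --> X](scale0r x).
  by apply: cvgZr_tmp; exact: cvg_at_left_filter cvg_id.
(* The relative neighbourhood of 0 is pulled back along [t *: x]; the left filter at 0 supplies the
   sign of [t]. *)
have CZ : \forall t \near (0 : R)^'-, t < 0 /\
    (affine_hull C (t *: x) -> C (t *: x)).
  by apply: filterI; [exact: nbhs_left_lt|exact: Zx C0].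
have [t [t0 Ct]] := filter_ex CZ.
exists t => //; apply: Ct => B [affB CB].
(* An affine combination of [x] and 0, both of which lie in [B]. *)
rewrite -[t *: x]addr0 -(scaler0 _ (1 - t)).
by apply: (affB); [exact: CB|exact: aff0].
Qed.

(** Supplies the half-space for both parts: [c] is 0 in the first and positive in the second. *)
Lemma node_increments_ge (R : realType) (d : nat) (U : Type)
    (TS : set (trajectory R d U)) (Phi : position TS) (S : TS) (k : nat)
    (c : R) :
  (c%:E <= inf_node_gain Phi S k)%E ->
  node_increments S k `<=` [set x | c <= dot (Phi k S).2 x].
Proof.
move=> cinf _ [S' S'k <-]; rewrite /= -lee_fin (le_trans cinf) //.
by apply: ereal_inf_lbound; exists S'.
Qed.

Theorem proposition3 (R : realType) (d : nat) (U : Type)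
    (Sigma : nat -> set 'rV[R]_d.+1) (Omega : nat -> set U) (Theta : set nat)
    (s0 : 'rV[R]_d.+1) (w0 : U) (hw0 : Omega 0%N w0)
    (TS : set (trajectory R d U))
    (hTS : trajectory_set Sigma Omega Theta s0 w0 TS)
    (S : TS) (k : nat) :
  (relative_interior (convex_hull (node_increments S k)) 0 ->
   forall H : set (position TS), admissible H -> arbitrage_free_node H S k) /\
  (closure (convex_hull (node_increments S k)) 0 ->
   forall H : set (position TS), admissible H -> zero_neutral_node H S k).
Proof.
split=> [ri0 H _ Phi _|cl0 H _ Phi _].
- have [|inf_ge0] := ltP (inf_node_gain Phi S k) 0%E; [by right|left].
  have hull_ge0 := convex_hull_dot_ge (node_increments_ge inf_ge0).
  move=> S' S'k; have Cx : convex_hull (node_increments S k) (increment k S').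
    by apply: sub_gen_smallest; exists S'.
  have [t t0 Ct] := relative_interior0_opp ri0 Cx.
  (* The gain is nonnegative at [x] and at [t *: x]; as [t < 0], the latter makes it nonpositive at
     [x]. *)
  apply/eqP; rewrite eq_le (hull_ge0 _ Cx) andbT.
  by have := hull_ge0 _ Ct; rewrite /= dotZr nmulr_rge0.
- rewrite leNgt; apply/negP => inf_gt0.
  (* A real bound is needed, but the infimum is [+oo] when the node set is empty; 1 then serves. *)
  have [c c0 cinf] : exists2 c : R, 0 < c & (c%:E <= inf_node_gain Phi S k)%E.
    case: (inf_node_gain Phi S k) inf_gt0 => [r r0||//]; first by exists r.
    by exists 1; rewrite ?leey.
  have := closure_dot_ge (convex_hull_dot_ge (node_increments_ge cinf)) cl0.
  by rewrite /= dotr0 leNgt c0.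
Qed.
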